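(* Let $G$ and $H$ be connected, singularly cospectral graphs having exactly three distinct nonzero singular values (not counting multiplicities), such that $In(G)=In(H)$. Then $G$ and $H$ are almost cospectral.
   Context: All graphs are finite and simple. The singular values of a graph are the singular values of its adjacency matrix (equivalently the absolute values of its eigenvalues). Two graphs are singularly cospectral if they have the same nonzero singular values with the same multiplicities. Two graphs are almost cospectral if their nonzero adjacency eigenvalues, with multiplicities, coincide. The inertia $In(X)=(p(X),z(X),n(X))$ records the numbers of positive, zero and negative adjacency eigenvalues of $X$, counted with multiplicity. *)

(* Defs.v *)
From HB Require Import structures.
From mathcomp Require Import all_boot all_order all_algebra.
From mathcomp Require Import polyrcf.

Set Implicit Arguments.
Unset Strict Implicit.
Unset Printing Implicit Defensive.

Import Order.TTheory GRing.Theory Num.Theory.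
Local Open Scope ring_scope.

Record sgraph := SGraph {
  vertex :> finType;
  edge : rel vertex;
  edge_sym : symmetric edge;
  edge_irrefl : irreflexive edge
}.

Definition connected_graph (G : sgraph) : Prop :=
  (0 < #|G|)%N /\ forall x y : G, connect (@edge G) x y.

Definition adjmx (R : rcfType) (G : sgraph) : 'M[R]_#|G| :=
  \matrix_(i, j) (edge (enum_val i) (enum_val j))%:R.

(* The eigenvalues of M lying in R, each repeated according to its multiplicity
   as a root of the characteristic polynomial.  The matrices M considered here
   are symmetric, so all their eigenvalues lie in R. *)
Definition eigenvalues (R : rcfType) (n : nat) (M : 'M[R]_n) : seq R :=
  flatten [seq nseq (mup x (char_poly M)) x | x <- rootsR (char_poly M)].

Definition singular_values (R : rcfType) (n : nat) (M : 'M[R]_n) : seq R :=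
  [seq Num.sqrt x | x <- eigenvalues (M^T *m M)].

Definition nonzero_eigenvalues (R : rcfType) (G : sgraph) : seq R :=
  [seq x <- eigenvalues (adjmx R G) | x != 0].

Definition nonzero_singular_values (R : rcfType) (G : sgraph) : seq R :=
  [seq s <- singular_values (adjmx R G) | s != 0].

Definition singularly_cospectral (R : rcfType) (G H : sgraph) : Prop :=
  perm_eq (nonzero_singular_values R G) (nonzero_singular_values R H).

Definition almost_cospectral (R : rcfType) (G H : sgraph) : Prop :=
  perm_eq (nonzero_eigenvalues R G) (nonzero_eigenvalues R H).

Definition num_distinct_nonzero_singular_values
    (R : rcfType) (G : sgraph) : nat :=
  size (undup (nonzero_singular_values R G)).

Definition inertia (R : rcfType) (G : sgraph) : nat * nat * nat :=
  let s := eigenvalues (adjmx R G) in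
  (count (fun x => 0 < x) s, count (fun x => x == 0) s,
   count (fun x => x < 0) s).

(* Main.v *)
Require Import Defs.
From mathcomp Require Import all_boot all_order all_algebra.
From mathcomp Require Import polyrcf complex lra.

(** Let [s1 > s2 > s3] be the common nonzero singular values, and let [a_i] be
the multiplicity of [s_i] as an eigenvalue.  By Perron-Frobenius, connectedness
forces [a_1 = 1] in both graphs.  The traces vanish, the inertias agree, and the
multiplicities of [s_i] and [- s_i] have the same sum in [G] and [H], so the
differences [D_i] of the [a_i] satisfy [D_2 + D_3 = 0] and
[s2 D_2 + s3 D_3 = 0]; hence they are all zero.

For Perron-Frobenius, diagonalise the adjacency matrix unitarily over [R[i]]: an
eigenvector for [s1] or [- s1] becomes, after taking absolute values entrywise,
a maximiser of the Rayleigh quotient, hence an eigenvector for [s1]; by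
irreducibility it has no zero entry.  So two independent eigenvectors for [s1]
cannot exist, since some combination of them would have a zero entry. *)

Set Implicit Arguments.
Unset Strict Implicit.
Unset Printing Implicit Defensive.

Import Order.TTheory GRing.Theory Num.Theory.
Local Open Scope ring_scope.
Local Open Scope sesquilinear_scope.

Lemma mul_row_trmxC (C : numClosedFieldType) n (x y : 'rV[C]_n) :
  (x *m y^t*) 0 0 = \sum_i x 0 i * (y 0 i)^*.
Proof. by rewrite mxE; apply: eq_bigr => i _; rewrite !mxE. Qed.

(** * Perron-Frobenius for a unitarily diagonalised irreducible nonnegative matrix *)

Section Perron.

Variables (C : numClosedFieldType) (n : nat).
Variables (A P : 'M[C]_n) (d : 'rV[C]_n) (lam : C).
Hypothesis unitaryP : P \is unitarymx.
Hypothesis AE : A = P^t* *m diag_mx d *m P.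
Hypothesis A_ge0 : forall i j, 0 <= A i j.
Hypothesis A_irr : forall i j, connect [rel u v | A u v != 0] i j.
Hypothesis d_real : forall i, d 0 i \is Num.real.
Hypothesis d_le : forall i, `|d 0 i| <= lam.

Lemma row_eigenvector i : row i P *m A = d 0 i *: row i P.
Proof.
rewrite -row_mul AE !mulmxA (unitarymxP unitaryP) mul1mx mul_diag_mx.
by apply/rowP => j; rewrite !mxE.
Qed.

(** The rows of [P] form an orthonormal eigenbasis; [y] holds the coordinates of [x] in it, where
    both quadratic forms are diagonal. *)
Lemma rayleigh_gap (x : 'rV[C]_n) (y := x *m P^t*) :
  lam * (x *m x^t*) 0 0 - (x *m A *m x^t*) 0 0 =
  \sum_i (lam - d 0 i) * `|y 0 i| ^+ 2.
Proof.
have yt : y^t* = P *m x^t* by rewrite /y trmx_mul map_mxM /= trmxCK.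
have -> : x *m x^t* = y *m y^t* by rewrite yt !mulmxA mulmxKtV.
have -> : x *m A *m x^t* = (y *m diag_mx d) *m y^t* by rewrite AE yt !mulmxA.
clearbody y; rewrite !mul_row_trmxC mulr_sumr -sumrB; apply: eq_bigr => i _.
by rewrite mul_mx_diag mxE normCK mulrBl [y 0 i * d 0 i]mulrC -mulrA.
Qed.

(** By [d_le] the gap is a sum of nonnegative terms, so a gap at most 0 kills every [y 0 i] with
    [d 0 i] different from [lam]. *)
Lemma rayleigh_eq (x : 'rV[C]_n) :
  lam * (x *m x^t*) 0 0 <= (x *m A *m x^t*) 0 0 -> x *m A = lam *: x.
Proof.
rewrite -subr_le0 rayleigh_gap; set y := x *m P^t* => gap_le0.
have ge0 i : 0 <= (lam - d 0 i) * `|y 0 i| ^+ 2.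
  rewrite mulr_ge0 ?exprn_ge0 // subr_ge0 (le_trans _ (d_le i)) //.
  exact: real_ler_norm.
have /eqP : \sum_i (lam - d 0 i) * `|y 0 i| ^+ 2 = 0.
  by apply/eqP; rewrite eq_le gap_le0 sumr_ge0.
rewrite psumr_eq0 // => /allP gap0.
have -> : x = y *m P by rewrite mulmxKtV.
rewrite AE !mulmxA mulmxtVK // scalemxAl; congr (_ *m P).
apply/rowP => i; rewrite mul_mx_diag [LHS]mxE [RHS]mxE.
have := gap0 i (mem_index_enum i).
rewrite mulf_eq0 subr_eq0 expf_eq0 normr_eq0 /= mulrC => /orP[/eqP->//|/eqP y0].
by rewrite y0 !mulr0.
Qed.

(** The triangle inequality bounds [lam * |x_j|] by the sum of [|x_i| * A i j]; multiplying by
    [|x_j|] and summing over [j] puts the entrywise norm under [rayleigh_eq]. *)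
Lemma norm_eigenvector (x : 'rV[C]_n) mu : `|mu| = lam -> x *m A = mu *: x ->
  map_mx Num.norm x *m A = lam *: map_mx Num.norm x.
Proof.
move=> mu_lam xA; apply: rayleigh_eq; rewrite !mul_row_trmxC mulr_sumr.
apply: ler_sum => j _; rewrite !mxE conj_normC mulrA ler_wpM2r //.
rewrite -mu_lam -normrM.
have -> : mu * x 0 j = \sum_i x 0 i * A i j.
  by have /rowP/(_ j) := xA; rewrite !mxE => <-.
apply: le_trans (ler_norm_sum _ _ _) _; apply: ler_sum => i _.
by rewrite normrM !mxE [`|A i j|]ger0_norm.
Qed.

(** At a zero [v], the equation for the norm vector is a vanishing sum of nonnegative terms, so each
    [u] with [A u v] nonzero is a zero too: zeros spread backwards along paths ending at [i]. *)
Lemma extremal_eigenvector_eq0 (x : 'rV[C]_n) mu i :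
  `|mu| = lam -> x *m A = mu *: x -> x 0 i = 0 -> x = 0.
Proof.
move=> mu_lam /(norm_eigenvector mu_lam) zA xi0.
have step u v : x 0 v = 0 -> A u v != 0 -> x 0 u = 0.
  move=> xv0 Auv; have /rowP/(_ v) := zA.
  rewrite !mxE xv0 normr0 mulr0 => /eqP; rewrite psumr_eq0 => [|k _]; last first.
    by rewrite mulr_ge0 // mxE.
  move=> /allP/(_ u (mem_index_enum u)).
  by rewrite /= mxE mulf_eq0 (negPf Auv) orbF normr_eq0 => /eqP.
apply/rowP => u; rewrite mxE; have /connectP[p] := A_irr u i.
elim: p u => [|w p IHp] u /= => [_ <- //|/andP[Auw /IHp xw0] /xw0 xw].
exact: step Auw.
Qed.

(** As [d 0 i0] may be [- lam], both the occurrence of [lam] and its uniqueness need proof. *)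
Lemma perron_simple i0 : `|d 0 i0| = lam ->
  exists i, [set j | d 0 j == lam] = [set i].
Proof.
move=> di0.
have rowN0 i : row i P != 0.
  apply/eqP => Pi0; have := row_unitarymxP unitaryP i i.
  by rewrite Pi0 dotmxE mul0mx mxE eqxx => /esym/eqP; rewrite oner_eq0.
have uniq_d i j : d 0 i = lam -> d 0 j = lam -> i = j.
  move=> di dj; have lam_norm : `|lam| = lam by rewrite -di0 normr_id.
  (* The coefficients make the combination vanish at coordinate [i0]; any coordinate would do. *)
  set x := P j i0 *: row i P - P i i0 *: row j P.
  have xA : x *m A = lam *: x.
    rewrite mulmxBl -!scalemxAl !row_eigenvector di dj scalerBr.
    by rewrite !scalerA ![lam * _]mulrC.
  have x0 : x = 0.
    apply: (extremal_eigenvector_eq0 (i := i0)) xA _ => //.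
    by rewrite !mxE mulrC subrr.
  apply/eqP; apply: contraT => neq_ij.
  (* By orthonormality, pairing with row [j] leaves [- P i i0 = 0]; so row [i] has a zero entry and
     vanishes, which is absurd. *)
  have := congr1 (fun z => dotmx z (row j P)) x0.
  rewrite !dotmxE mul0mx mulmxBl -!scalemxAl !mxE.
  have := row_unitarymxP unitaryP i j; rewrite dotmxE mxE (negPf neq_ij) => ->.
  have := row_unitarymxP unitaryP j j; rewrite dotmxE mxE eqxx => ->.
  rewrite mulr0 mulr1 sub0r => /eqP; rewrite oppr_eq0 => /eqP Pii0.
  have := rowN0 i.
  rewrite (extremal_eigenvector_eq0 (i := i0) lam_norm (x := row i P)) ?eqxx //.
    by rewrite row_eigenvector di.
  by rewrite mxE.
have [i di] : exists i, d 0 i = lam.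
  have /existsP[i /eqP di] : [exists i, d 0 i == lam]; last by exists i.
  apply: contraT => /existsPn nolam.
  (* The entrywise norm of row [i0] is an eigenvector for [lam]; were no [d 0 i] equal to [lam], all
     its coordinates in the eigenbasis would vanish. *)
  have zA := norm_eigenvector di0 (row_eigenvector i0).
  set z := map_mx _ _ in zA.
  have z0 : z *m P^t* = 0.
    apply/rowP => i; rewrite [RHS]mxE; apply/eqP.
    have := congr1 (fun w => (w *m P^t*) 0 i) zA.
    rewrite AE !mulmxA mulmxtVK // mul_mx_diag -scalemxAl !mxE => /eqP.
    by rewrite mulrC -subr_eq0 -mulrBl mulf_eq0 subr_eq0 (negPf (nolam i)).
  have /eqP : z = 0 by rewrite -[z](mulmxKtV _ unitaryP) // z0 mul0mx.
  move=> /eqP/rowP z00; case/eqP: (rowN0 i0); apply/rowP => j.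
  by have := z00 j; rewrite !mxE => /eqP; rewrite normr_eq0 => /eqP.
exists i; apply/setP => j; rewrite !inE.
by apply/eqP/eqP => [dj|->//]; apply: uniq_d.
Qed.

End Perron.

(** * Spectra and singular values of real symmetric matrices *)

Lemma char_poly_conj_diag (F : fieldType) n (P : 'M[F]_n) (d : 'rV[F]_n) :
  P \in unitmx ->
  char_poly (invmx P *m diag_mx d *m P) = \prod_i ('X - (d 0 i)%:P).
Proof.
move=> Pu.
have -> : char_poly (invmx P *m diag_mx d *m P) = char_poly (diag_mx d).
  rewrite /char_poly /char_poly_mx; set D := diag_mx d.
  have PVP : map_mx polyC (invmx P) *m map_mx polyC P = 1%:M.
    by rewrite -map_mxM mulVmx // map_mx1.
  have -> : 'X%:M - map_mx polyC (invmx P *m D *m P) =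
      map_mx polyC (invmx P) *m ('X%:M - map_mx polyC D) *m map_mx polyC P.
    rewrite mulmxBr mulmxBl -!map_mxM; congr (_ - _).
    by rewrite mul_mx_scalar -scalemxAl PVP scalemx1.
  by rewrite !det_mulmx mulrAC -det_mulmx PVP det1 mul1r.
rewrite char_poly_trig ?diag_mx_is_trig //.
by apply: eq_bigr => i _; rewrite mxE eqxx mulr1n.
Qed.

Lemma count_flatten_nseq (T : eqType) (c : T -> nat) (s : seq T) y : uniq s ->
  count_mem y (flatten [seq nseq (c x) x | x <- s]) =
  (if y \in s then c y else 0)%N.
Proof.
elim: s => //= x s IHs /andP[xs /IHs {}IHs].
rewrite count_cat count_nseq IHs inE [y == x]eq_sym /=.
by case: (eqVneq x y) => [<-|_]; rewrite ?(negPf xs) ?mul1n ?addn0 ?mul0n.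
Qed.

(** Both lists contain [y] as often as its multiplicity as a root: [rootsR] has each root once, and
    in a product of linear factors the multiplicity is the count in [s]. *)
Lemma eigenvalues_split (R : rcfType) n (M : 'M[R]_n) (s : seq R) :
  char_poly M = \prod_(x <- s) ('X - x%:P) -> perm_eq (eigenvalues M) s.
Proof.
move=> chiM; have chiN0 : char_poly M != 0 by rewrite monic_neq0 ?char_poly_monic.
apply/allP => y _ /=; apply/eqP.
rewrite count_flatten_nseq; last exact/sorted_uniq/sorted_roots/ltxx/lt_trans.
have /= <- := roots_on_rootsR chiN0 y.
rewrite -mu_prod_XsubC -chiM; case: ifPn => //.
by move=> /mupNroot ->.
Qed.

(** This is the spectral theorem over [R[i]]; the diagonal of a Hermitian matrix is real, so it
    descends to [R]. The same [P] diagonalises [A^T *m A] with squared entries, whence singular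
    values are absolute values of eigenvalues. *)
Lemma symmetric_spectral (R : rcfType) n (A : 'M[R]_n) : A^T = A ->
  exists (P : 'M[R[i]%C]_n) (d : 'rV[R]_n),
  [/\ P \is unitarymx,
      map_mx (real_complex R) A =
        P^t* *m diag_mx (map_mx (real_complex R) d) *m P,
      perm_eq (eigenvalues A) [seq d 0 i | i : 'I_n] &
      perm_eq (eigenvalues (A^T *m A)) [seq d 0 i ^+ 2 | i : 'I_n]].
Proof.
move=> Asym; set f := real_complex R; set AC := map_mx f A.
have AC_real : AC \is a realmx.
  by apply/mxOverP => i j; rewrite mxE complex_real.
have AC_herm : AC \is hermsymmx.
  apply: realsym_hermsym AC_real; apply/is_hermitianmxP.
  by rewrite expr0 scale1r map_mx_id // map_trmx Asym.
have Pu := spectral_unitarymx AC; set P := spectralmx AC in Pu.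
have := orthomx_spectralP (hermitian_normalmx AC_herm).
have := hermitian_spectral_diag_real AC_herm; rewrite -/P.
set D := spectral_diag AC => /mxOverP D_real ACE.
pose d := map_mx (@complex.Re R) D.
have DE : D = map_mx f d by apply/rowP => i; rewrite !mxE; apply/esym/RRe_real.
rewrite DE in ACE; exists P, d; split=> //.
- by rewrite -invmx_unitary.
(* The factorisation is checked over [R[i]] and pulled back along the injective embedding. *)
- apply: eigenvalues_split; apply: (@map_poly_inj _ _ f).
  rewrite map_char_poly -/AC ACE char_poly_conj_diag ?unitarymx_unit //.
  rewrite big_image rmorph_prod; apply: eq_bigr => i _ /=.
  by rewrite mxE rmorphB /= map_polyX map_polyC.
- apply: eigenvalues_split; apply: (@map_poly_inj _ _ f).
  rewrite map_char_poly map_mxM Asym -/AC ACE.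
  rewrite -!mulmxA mulKVmx ?unitarymx_unit // !mulmxA.
  rewrite -[_ *m diag_mx _ *m diag_mx _]mulmxA.
  rewrite mulmx_diag char_poly_conj_diag ?unitarymx_unit //.
  rewrite big_image rmorph_prod; apply: eq_bigr => i _ /=.
  by rewrite !mxE rmorphB /= map_polyX map_polyC /= rmorphXn.
Qed.

Lemma singular_values_symmetric (R : rcfType) n (A : 'M[R]_n) : A^T = A ->
  perm_eq (singular_values A) [seq `|x| | x <- eigenvalues A].
Proof.
move=> /symmetric_spectral[P [d [_ _ eA eA2]]].
rewrite (perm_trans (perm_map _ eA2)) // perm_sym (perm_trans (perm_map _ eA)) //.
by rewrite -!map_comp; under eq_map => i do rewrite /= -sqrtr_sqr.
Qed.

Lemma sum_eigenvalues_symmetric (R : rcfType) n (A : 'M[R]_n) : A^T = A ->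
  \sum_(x <- eigenvalues A) x = \tr A.
Proof.
move=> /symmetric_spectral[P [d [Pu AE eA _]]].
rewrite (perm_big _ eA) big_image /=; apply: (@complexI R).
have -> : ((\tr A)%:C)%C = \tr (map_mx (real_complex R) A) by rewrite trace_map_mx.
rewrite AE mxtrace_mulC mulmxA (unitarymxP Pu) mul1mx mxtrace_diag rmorph_sum.
by apply: eq_bigr => i _; rewrite mxE.
Qed.

(** This carries [perron_simple] back from [R[i]] to [R]: the multiplicity of [lam] is the number of
    [j] with [d 0 j = lam]. *)
Lemma perron_count (R : rcfType) n (A : 'M[R]_n) (lam : R) :
  A^T = A -> (forall i j, 0 <= A i j) ->
  (forall i j, connect [rel u v | A u v != 0] i j) ->
  lam \in [seq `|x| | x <- eigenvalues A] ->
  {in eigenvalues A, forall x, `|x| <= lam} ->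
  count_mem lam (eigenvalues A) = 1%N.
Proof.
move=> /symmetric_spectral[P [d [Pu AE eA _]]] A_ge0 A_irr lam_in lam_max.
have normC (x : R) : `|(x%:C)%C| = (`|x|%:C)%C.
  by rewrite normc_def /= expr0n addr0 sqrtr_sqr.
move: lam_in => /mapP[x]; rewrite (perm_mem eA) => /imageP[i0 _ ->] lamE.
have AC_ge0 i j : 0 <= map_mx (real_complex R) A i j by rewrite mxE ler0c.
have AC_irr i j : connect [rel u v | map_mx (real_complex R) A u v != 0] i j.
  rewrite (@eq_connect _ _ [rel u v | A u v != 0]) // => u v /=.
  by rewrite mxE fmorph_eq0.
have dC_real i : map_mx (real_complex R) d 0 i \is Num.real.
  by rewrite mxE complex_real.
have dC_le i : `|map_mx (real_complex R) d 0 i| <= (lam%:C)%C.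
  by rewrite mxE normC lecR lam_max // (perm_mem eA) image_f.
have [|i lam_i] := perron_simple Pu AE AC_ge0 AC_irr dC_real dC_le (i0 := i0).
  by rewrite mxE normC lamE.
rewrite (permP eA) count_map -[RHS](cards1 i) -lam_i cardE size_filter enumT.
by apply: eq_count => j /=; rewrite !inE mxE (inj_eq (@complexI R)).
Qed.

(** * Trace, irreducibility and largest eigenvalue of adjacency matrices *)

Lemma adjmx_sym (R : rcfType) (G : sgraph) : (adjmx R G)^T = adjmx R G.
Proof. by apply/matrixP => i j; rewrite !mxE edge_sym. Qed.

Lemma sum_eigenvalues_adjmx (R : rcfType) (G : sgraph) :
  \sum_(x <- eigenvalues (adjmx R G)) x = 0.
Proof.
rewrite sum_eigenvalues_symmetric ?adjmx_sym // /mxtrace big1 // => i _.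
by rewrite mxE edge_irrefl.
Qed.

Lemma adjmx_connect (R : rcfType) (G : sgraph) : connected_graph G ->
  forall i j, connect [rel u v | adjmx R G u v != 0] i j.
Proof.
move=> [_ connG] i j; rewrite -[j]enum_valK.
have /connectP[p] := connG (enum_val i) (enum_val j); move: (enum_val j) => y.
elim: p i => [|z p IHp] i /= => [_ ->|/andP[iz pz] y_last].
  by rewrite enum_valK connect0.
apply: (@connect_trans _ _ (enum_rank z)); last first.
  by apply: IHp; rewrite enum_rankK.
by apply: connect1; rewrite /= mxE enum_rankK iz oner_eq0.
Qed.

Lemma adjmx_perron (R : rcfType) (G : sgraph) (lam : R) : connected_graph G ->
  lam \in nonzero_singular_values R G ->
  {in nonzero_singular_values R G, forall x, x <= lam} ->
  count_mem lam (eigenvalues (adjmx R G)) = 1%N.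
Proof.
move=> connG; have sE := singular_values_symmetric (adjmx_sym R G).
rewrite mem_filter (perm_mem sE) => /andP[lam0 lam_in] lam_max.
have lam_ge0 : 0 <= lam by have /mapP[x _ ->] := lam_in.
apply: perron_count => //.
- exact: adjmx_sym.
- by move=> i j; rewrite mxE ler0n.
- exact: adjmx_connect.
move=> x xe; have [->|xN0] := eqVneq x 0; first by rewrite normr0.
by apply: lam_max; rewrite mem_filter normr_eq0 xN0 (perm_mem sE) map_f.
Qed.

(** * Recovering multiplicities from linear relations *)

Lemma sum_count_mem (R : pzRingType) (F : R -> R) (S p : seq R) :
  uniq S -> {subset p <= S} ->
  \sum_(x <- p) F x = \sum_(s <- S) F s *+ count_mem s p.
Proof.
move=> S_uniq; elim: p => [|x p IHp] sub.
  by rewrite big_nil big1 // => s _; rewrite mulr0n.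
rewrite big_cons IHp => [|y yp]; last by rewrite sub // inE yp orbT.
have xS : x \in S by rewrite sub ?mem_head.
rewrite !(bigD1_seq x xS S_uniq) /= eqxx mulrS addrA; congr (_ + _).
by apply: eq_bigr => y /negPf yx; rewrite eq_sym yx.
Qed.

(** The graph-free core: [e] and [f] stand for the two spectra, and [N] extracts the nonzero
    singular values. For graphs, the equal sums are traces and the last hypothesis is
    Perron-Frobenius. *)
Lemma perm_eq_of_norms (R : rcfType) (e f : seq R)
    (N := fun g : seq R => [seq x : R <- [seq `|x| : R | x <- g] | x != 0]) :
  perm_eq (N e) (N f) ->
  size (undup (N e)) = 3%N ->
  \sum_(x <- e) x = \sum_(x <- f) x ->
  count (fun x => 0 < x) e = count (fun x => 0 < x) f ->
  (forall m : R, m \in N e -> {in N e, forall x : R, x <= m} ->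
     count_mem m e = count_mem m f) ->
  perm_eq [seq x <- e | x != 0] [seq x <- f | x != 0].
Proof.
pose pos := fun g : seq R => [seq x : R <- g | 0 < x].
move=> eqN sizeN eq_sum eq_pos eq_max.
have sumN g : \sum_(x <- g) `|x| = \sum_(x <- N g) x.
  rewrite big_filter big_map [LHS](bigID (fun x => `|x| == 0)) /=.
  by rewrite big1 ?add0r // => x /eqP.
(* [x + |x|] is [2x] for positive [x] and 0 otherwise. *)
have sum_posE g : \sum_(x <- pos g) x *+ 2 = \sum_(x <- g) x + \sum_(x <- N g) x.
  rewrite -sumN -big_split big_filter [RHS](bigID (fun x => 0 < x)) /=.
  rewrite [X in _ + X]big1 ?addr0 => [|x]; last first.
    by rewrite -leNgt => /ler0_norm->; rewrite subrr.
  by apply: eq_bigr => x /gtr0_norm->.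
have sum_pos : \sum_(x <- pos e) x = \sum_(x <- pos f) x.
  have := sum_posE e.
  by rewrite eq_sum (perm_big _ eqN) -sum_posE !sumrMnl => /pmulrnI; apply.
pose S : seq R := sort >=%R (undup (N e)).
have memS : S =i N e by move=> x; rewrite mem_sort mem_undup.
have S_uniq : uniq S by rewrite sort_uniq undup_uniq.
have posS g : N g =i N e -> {subset pos g <= S}.
  move=> gN x; rewrite mem_filter => /andP[x0 xg].
  by rewrite memS -gN mem_filter gt_eqF //= -(gtr0_norm x0) map_f.
have count_pos g (s : R) : 0 < s -> count_mem s (pos g) = count_mem s g.
  move=> s0; rewrite count_filter; apply: eq_count => x /=.
  by case: eqVneq => // ->; rewrite s0.
(* Taking [F] to be the identity, then the constant 1, yields two linear relations between the
   multiplicity differences; in both the left side vanishes. *)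
have sumF (F : R -> R) : \sum_(x <- pos e) F x - \sum_(x <- pos f) F x =
    \sum_(s <- S) F s * ((count_mem s e)%:R - (count_mem s f)%:R).
  rewrite (sum_count_mem F S_uniq (posS _ _)) //.
  rewrite (sum_count_mem F S_uniq (posS _ _)) => [|x]; last first.
    by rewrite (perm_mem eqN).
  rewrite -sumrB; apply: eq_big_seq => s.
  rewrite memS mem_filter => /andP[sN0 /mapP[x _ sx]].
  have s0 : 0 < s by rewrite lt0r sN0 sx /=.
  by rewrite !count_pos // mulrBr !mulr_natr.
have sum1 g : \sum_(x <- pos g) (1 : R) = (count (fun x => 0 < x) g)%:R.
  by rewrite big_const_seq count_predT size_filter -Monoid.iteropE.
have eqS : {in S, forall s : R, count_mem s e = count_mem s f}.
  have := sumF id; have := sumF (fun=> 1).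
  rewrite sum_pos subrr !sum1 eq_pos subrr.
  have : sorted >=%R S by apply: sort_sorted => x y; apply: le_total.
  have : size S = 3%N by rewrite size_sort.
  case: S S_uniq memS {posS sumF} => [|a [|b [|c []]]] //=.
  rewrite !inE !andbT => /andP[_ bNc] memS _ /andP[ba cb].
  rewrite !big_cons !big_nil => sum1S sumS.
  have Da : count_mem a e = count_mem a f.
    apply: eq_max => [|x]; rewrite -memS !inE ?eqxx //.
    by move=> /or3P[]/eqP-> //; apply: le_trans ba.
  have Db : (count_mem b e)%:R - (count_mem b f)%:R = 0 :> R.
    have bc0 : b - c != 0 by rewrite subr_eq0.
    (* With the term of [a] gone, the weighted relation minus [c] times the plain one is [b - c]
       times the difference at [b]. *)
    apply: (mulfI bc0); rewrite Da in sum1S sumS.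
    by have := congr1 ( *%R c) sum1S; lra.
  have Dc : (count_mem c e)%:R - (count_mem c f)%:R = 0 :> R.
    by rewrite Da in sum1S; lra.
  move=> x; rewrite !inE => /or3P[]/eqP-> //; apply/eqP; rewrite -(eqr_nat R) -subr_eq0.
    by rewrite Db.
  by rewrite Dc.
(* Since [s] is positive, [s] and [- s] differ and the two counts do not overlap. *)
have count_norm g (s : R) : 0 < s ->
    count_mem s (N g) = (count_mem s g + count_mem (- s) g)%N.
  move=> s0; rewrite count_filter count_map -[RHS]count_predUI.
  rewrite (@eq_count _ (predI _ _) pred0) ?count_pred0 ?addn0 => [|x /=].
    apply: eq_count => x /=; rewrite eqr_norml (ltW s0) andbT normr_eq0.
    have [->|_] := eqVneq x 0; last by rewrite andbT.
    by rewrite andbF ![0 == _]eq_sym oppr_eq0 gt_eqF.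
  by case: eqP => //= ->; apply/negbTE/eqP; lra.
have eq_count_pos (s : R) : 0 < s -> count_mem s e = count_mem s f.
  move=> s0; have [/eqS //|sS] := boolP (s \in S).
  have notin g : N g =i N e -> s \notin g.
    move=> gN; apply: contra sS => sg.
    by apply: (posS g gN); rewrite mem_filter s0.
  have /count_memPn-> := notin e (fun=> erefl).
  by have /count_memPn-> := notin f (fun x => esym (perm_mem eqN x)).
apply/allP => x _ /=; rewrite !count_filter; apply/eqP.
have [->|xN0] := eqVneq x 0.
  by rewrite !(@eq_count _ _ pred0) ?count_pred0 // => y /=; case: eqP.
have cE g : count (predI (pred1 x) (fun y => y != 0)) g = count_mem x g.
  by apply: eq_count => y /=; case: eqP => // ->; rewrite xN0.
rewrite !cE; have [x0|x0] := ltP 0 x; first exact: eq_count_pos.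
(* For negative [x], [N e] and [N f] contain [- x] equally often, and the equal contributions of the
   positive eigenvalue [- x] cancel. *)
have Nx0 : 0 < - x by rewrite oppr_gt0 lt_neqAle xN0.
have := permP eqN (pred1 (- x)); rewrite !count_norm // opprK.
by rewrite eq_count_pos // => /addnI.
Qed.

Theorem theorem5p4 (R : rcfType) (G H : sgraph)
  (connG : connected_graph G) (connH : connected_graph H)
  (scospGH : singularly_cospectral R G H)
  (threeG : num_distinct_nonzero_singular_values R G = 3%N)
  (threeH : num_distinct_nonzero_singular_values R H = 3%N)
  (inertiaGH : inertia R G = inertia R H) :
  almost_cospectral R G H.
Proof.
have normE (K : sgraph) : perm_eq (nonzero_singular_values R K)
    [seq x <- map Num.norm (eigenvalues (adjmx R K)) | x != 0].
  by rewrite perm_filter // singular_values_symmetric ?adjmx_sym.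
have memE (K : sgraph) := perm_mem (normE K).
case: inertiaGH => eq_pos _ _.
apply: perm_eq_of_norms => //.
- by rewrite -(permPl (normE G)) -(permPr (normE H)).
- by rewrite -(perm_size (perm_undup (memE G))).
- by rewrite !sum_eigenvalues_adjmx.
move=> m; rewrite -memE => mG m_max.
have {}m_max : {in nonzero_singular_values R G, forall x, x <= m}.
  by move=> x; rewrite memE; apply: m_max.
(* By [scospGH], [m] is also the largest nonzero singular value of [H], so both multiplicities are
   1. *)
rewrite !adjmx_perron // => [|x]; rewrite -(perm_mem scospGH) //.
exact: m_max.
Qed.
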